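(* Let $n\in\mathbb{N}$ and fix a non-degenerate, symmetric bilinear form on $\mathbb{Q}_2^n$. Let $U_1, U_2 \in \mathrm{M}_{n\times n}(\mathbb{Z}_2)$ be matrices that are orthogonal with respect to this bilinear form and such that $U_1 \equiv U_2 \pmod 4$. (a) If $U_1 \equiv E_n \pmod 2$, then $\mathrm{Tr}(U_1) \equiv \mathrm{Tr}(U_2) \pmod{16}$. (b) If $U_1^2 \equiv E_n \pmod 2$, then $\mathrm{Tr}(U_1) \equiv \mathrm{Tr}(U_2) \pmod 8$.
   Context: $\mathbb{Z}_2$ and $\mathbb{Q}_2$ denote the $2$-adic integers and the $2$-adic numbers, and $E_n$ is the $n\times n$ identity matrix. A matrix $U$ is orthogonal with respect to a bilinear form $b$ if $b(Ux,Uy)=b(x,y)$ for all vectors $x,y$. Congruences between matrices are understood entrywise, in $\mathbb{Z}_2$. *)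

(* Defs.v *)
From HB Require Import structures.
From mathcomp Require Import all_boot all_order all_algebra.
From mathcomp Require Import boolp.

Set Implicit Arguments.
Unset Strict Implicit.
Unset Printing Implicit Defensive.

Import GRing.Theory.
Local Open Scope ring_scope.

(* The ring of 2-adic integers is the inverse limit of the rings Z/2^(n+1)    *)
(* along the reduction maps. Indexing from exponent n+1 rather than n avoids  *)
(* the zero ring, for which 'Z_(2 ^ 0) would wrongly stand as a copy of Z/2.  *)

Record Z2adic := MkZ2adic {
  residue :> forall n : nat, 'Z_(2 ^ n.+1);
  residueP : forall n, residue n.+1 = residue n %[mod 2 ^ n.+1]
}.

HB.instance Definition _ := gen_eqMixin Z2adic.
HB.instance Definition _ := gen_choiceMixin Z2adic.

Lemma Z2adicP (x y : Z2adic) : (forall n, x n = y n) -> x = y.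
Proof.
case: x y => [x xP] [y yP] /= exy.
have {}exy : x = y by apply: functional_extensionality_dep.
by subst y; congr MkZ2adic; apply: Prop_irrelevance.
Qed.

Lemma expn2_gt1 n : (1 < 2 ^ n.+1)%N.
Proof. by rewrite -{1}(expn0 2) ltn_exp2l. Qed.

Lemma residue_trunc n : (Zp_trunc (2 ^ n.+1)).+2 = (2 ^ n.+1)%N.
Proof. exact: Zp_cast (expn2_gt1 n). Qed.

Lemma residue_mod_trunc m n k : (m <= n)%N ->
  (k %% (Zp_trunc (2 ^ n.+1)).+2 = k %[mod 2 ^ m.+1])%N.
Proof. by move=> le_mn; rewrite residue_trunc modn_dvdm // dvdn_exp2l. Qed.

Fact Z2adic0_subproof n :
  (0%R : 'Z_(2 ^ n.+2)) = (0%R : 'Z_(2 ^ n.+1)) %[mod 2 ^ n.+1].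
Proof. by []. Qed.

Fact Z2adic1_subproof n :
  (1%R : 'Z_(2 ^ n.+2)) = (1%R : 'Z_(2 ^ n.+1)) %[mod 2 ^ n.+1].
Proof. by []. Qed.

Fact Z2adic_opp_subproof (x : Z2adic) n :
  (- x n.+1)%R = (- x n)%R %[mod 2 ^ n.+1].
Proof.
rewrite /= !residue_mod_trunc //.
have := residueP x n; have := ltnW (ltn_ord (x n.+1)).
have := ltnW (ltn_ord (x n)); move: (x n : nat) (x n.+1 : nat) => a b.
rewrite !residue_trunc => le_a le_b eq_ba.
apply/eqP; rewrite -(eqn_modDr b) subnK // -[X in _ == X]modnDmr eq_ba.
by rewrite modnDmr subnK // modnn expnS modnMl.
Qed.

Fact Z2adic_add_subproof (x y : Z2adic) n :
  (x n.+1 + y n.+1)%R = (x n + y n)%R %[mod 2 ^ n.+1].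
Proof. by rewrite /= !residue_mod_trunc // -modnDm !residueP modnDm. Qed.

Fact Z2adic_mul_subproof (x y : Z2adic) n :
  (x n.+1 * y n.+1)%R = (x n * y n)%R %[mod 2 ^ n.+1].
Proof. by rewrite /= !residue_mod_trunc // -modnMm !residueP modnMm. Qed.

Definition Z2adic0 := MkZ2adic Z2adic0_subproof.
Definition Z2adic1 := MkZ2adic Z2adic1_subproof.
Definition Z2adic_opp (x : Z2adic) := MkZ2adic (Z2adic_opp_subproof x).
Definition Z2adic_add (x y : Z2adic) := MkZ2adic (Z2adic_add_subproof x y).
Definition Z2adic_mul (x y : Z2adic) := MkZ2adic (Z2adic_mul_subproof x y).

Fact Z2adic_addA : associative Z2adic_add.
Proof. by move=> x y z; apply: Z2adicP => n; apply: addrA. Qed.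
Fact Z2adic_addC : commutative Z2adic_add.
Proof. by move=> x y; apply: Z2adicP => n; apply: addrC. Qed.
Fact Z2adic_add0 : left_id Z2adic0 Z2adic_add.
Proof. by move=> x; apply: Z2adicP => n; apply: add0r. Qed.
Fact Z2adic_addN : left_inverse Z2adic0 Z2adic_opp Z2adic_add.
Proof. by move=> x; apply: Z2adicP => n; apply: addNr. Qed.

HB.instance Definition _ := GRing.isZmodule.Build Z2adic
  Z2adic_addA Z2adic_addC Z2adic_add0 Z2adic_addN.

Fact Z2adic_mulA : associative Z2adic_mul.
Proof. by move=> x y z; apply: Z2adicP => n; apply: mulrA. Qed.
Fact Z2adic_mulC : commutative Z2adic_mul.
Proof. by move=> x y; apply: Z2adicP => n; apply: mulrC. Qed.
Fact Z2adic_mul1 : left_id Z2adic1 Z2adic_mul.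
Proof. by move=> x; apply: Z2adicP => n; apply: mul1r. Qed.
Fact Z2adic_mulDl : left_distributive Z2adic_mul Z2adic_add.
Proof. by move=> x y z; apply: Z2adicP => n; apply: mulrDl. Qed.
Fact Z2adic_1neq0 : Z2adic1 != 0.
Proof. by apply/eqP => /(congr1 (fun x : Z2adic => x 0%N)). Qed.

HB.instance Definition _ := GRing.Zmodule_isComNzRing.Build Z2adic
  Z2adic_mulA Z2adic_mulC Z2adic_mul1 Z2adic_mulDl Z2adic_1neq0.

Definition Z2adic_unit : pred Z2adic := fun x => `[< exists y, y * x = 1 >].
Definition Z2adic_inv (x : Z2adic) : Z2adic :=
  if pselect (exists y, y * x = 1) is left ex then projT1 (cid ex) else x.

Fact Z2adic_mulV : {in Z2adic_unit, left_inverse 1 Z2adic_inv *%R}.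
Proof.
move=> x /asboolP ux; rewrite /Z2adic_inv; case: pselect => // ex.
by case: (cid ex).
Qed.
Fact Z2adic_unitP (x y : Z2adic) : y * x = 1 -> Z2adic_unit x.
Proof. by move=> yx; apply/asboolP; exists y. Qed.
Fact Z2adic_inv_out : {in [predC Z2adic_unit], Z2adic_inv =1 id}.
Proof.
by move=> x /asboolP nux; rewrite /Z2adic_inv; case: pselect.
Qed.

HB.instance Definition _ := GRing.ComNzRing_hasMulInverse.Build Z2adic
  Z2adic_mulV Z2adic_unitP Z2adic_inv_out.

Lemma residue_add (x : Z2adic) n m :
  (x (n + m)%N : nat) = x n %[mod 2 ^ n.+1].
Proof.
elim: m => [|m IHm]; first by rewrite addn0.
rewrite addnS -IHm -[LHS](@modn_dvdm (2 ^ (n + m).+1)) ?residueP.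
  by rewrite modn_dvdm // dvdn_exp2l // ltnS leq_addr.
by rewrite dvdn_exp2l // ltnS leq_addr.
Qed.

Lemma residue_ndvd (x : Z2adic) n m :
  x n != 0 -> ~~ (2 ^ n.+1 %| (x (n + m)%N : nat))%N.
Proof.
apply: contra; rewrite /dvdn residue_add modn_small; last first.
  by rewrite -[X in (_ < X)%N]residue_trunc ltn_ord.
by move=> /eqP x0; apply/eqP/val_inj.
Qed.

Fact Z2adic_idomain (x y : Z2adic) : x * y = 0 -> (x == 0) || (y == 0).
Proof.
move=> xy0; apply/orP; rewrite -!(rwP eqP); apply: contrapT => /not_orP[nx ny].
have [i xi] : exists i, x i != 0.
  apply: contrapT => nex; apply: nx; apply: Z2adicP => i.
  by apply/eqP; apply: contrapT => xi; apply: nex; exists i; apply/negP.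
have [j yj] : exists j, y j != 0.
  apply: contrapT => nex; apply: ny; apply: Z2adicP => j.
  by apply/eqP; apply: contrapT => yj; apply: nex; exists j; apply/negP.
have : (2 ^ (i + j).+1 %| x (i + j) * y (i + j))%N.
  have /(congr1 (fun z : Z2adic => (z (i + j)%N : nat))) /= xyij := xy0.
  by rewrite /dvdn -(@residue_mod_trunc _ (i + j)) // xyij mod0n.
have := residue_ndvd j xi; have := residue_ndvd i yj; rewrite (addnC j i).
move: (x _ : nat) (y _ : nat) => a b {nx ny xi yj xy0}.
case: (posnP a) => [->|a0]; first by rewrite dvdn0.
case: (posnP b) => [->|b0]; first by rewrite dvdn0.
rewrite !pfactor_dvdn ?muln_gt0 ?a0 // lognM // -!leqNgt => lb la.
by rewrite ltnNge leq_add.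
Qed.

HB.instance Definition _ :=
  GRing.ComUnitRing_isIntegral.Build Z2adic Z2adic_idomain.

Definition Q2adic : fieldType := {fraction Z2adic}.

Notation Z2adic_to_Q2adic := (@FracField.tofrac Z2adic) (only parsing).

Definition congr_mod (m : nat) (x y : Z2adic) : Prop :=
  exists z : Z2adic, x - y = m%:R * z.

Definition congr_mx_mod (m n : nat) (A B : 'M[Z2adic]_n) : Prop :=
  forall i j, congr_mod m (A i j) (B i j).

Definition orthogonal_wrt (n : nat) (b : {symmetric 'cV[Q2adic]_n})
    (U : 'M[Z2adic]_n) : Prop :=
  isometry b b (mulmx (map_mx Z2adic_to_Q2adic U)).

(* Main.v *)
(* Write * for the adjoint with respect to the form. The orthogonal matrix
   V = U1^-1 U2 is 1 + 4 X with X integral, and Tr U2 - Tr U1 = 4 Tr (U1 X).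
   From V* = V^-1 one gets X* = - X V^-1, and Tr (U1 X) = Tr (X* U1^-1) becomes
     Tr (U1 X) = Tr (X W) + 2 Tr (X^2 V^-1 U1^-1),  W = (U1 - U1^-1) / 2.
   The key fact is that Tr (T W) is even whenever T and W are integral and
   skew-adjoint. It applies to W, which is integral when U1^2 = 1 mod 2, and to
   T = (V - V^-1) / 8, which is integral and congruent to X mod 2; this gives
   (b). If moreover U1 = 1 mod 2, then W is twice an integral skew-adjoint
   matrix, and Tr (X^2 V^-1 U1^-1) = Tr X^2 = (Tr X)^2 = Tr (U1 X) = 0 mod 2,
   which gives (a).
   For the key fact, let B be the Gram matrix, so that A = T B^-1 and C = B W
   are alternating with A C = T W. Over a valuation ring, pivoting on entries of
   minimal valuation writes A = G A + A G^T with G integral, whence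
   Tr (A C) = 2 Tr (G A C). *)
Require Import Defs.
From mathcomp Require Import all_boot all_order all_algebra.
From mathcomp Require Import boolp.

Set Implicit Arguments.
Unset Strict Implicit.
Unset Printing Implicit Defensive.

Import GRing.Theory.
Local Open Scope ring_scope.

(** * Alternating matrices over a valuation ring *)

Section SkewSplitting.

Variables (R : comNzRingType) (F : fieldType) (f : {rmorphism R -> F}).
Hypothesis f_valuation : forall x y : F,
  (exists r, y = f r * x) \/ (exists r, x = f r * y).

(** Divisibility with integral quotients is a total preorder, so a finite family has an entry of
    minimal valuation; [i0] makes the family nonempty. *)
Lemma exists_common_divisor (I : finType) (x : I -> F) (i0 : I) :
  exists i, forall j, exists r, x j = f r * x i.
Proof.
have [i ri] : exists i, forall j, j \in i0 :: enum I ->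
    exists r, x j = f r * x i.
  elim: (enum I) => [|j s [i IHs]].
    exists i0 => j; rewrite inE => /eqP->.
    by exists 1; rewrite rmorph1 mul1r.
  have [[r xj]|[r xi]] := f_valuation (x i) (x j).
    exists i => k; rewrite !inE => /or3P[ki|/eqP->|ks]; last 2 first.
    - by exists r.
    - by apply: IHs; rewrite inE ks orbT.
    by apply: IHs; rewrite inE ki.
  exists j => k k_s.
  have [->|nkj] := eqVneq k j; first by exists 1; rewrite rmorph1 mul1r.
  have [|q xk] := IHs k.
    by move: k_s; rewrite !inE (negPf nkj).
  by exists (q * r); rewrite rmorphM -mulrA -xi.
by exists i => j; apply: ri; rewrite inE mem_enum orbT.
Qed.

Hypothesis two_neq0 : 2 != 0 :> F.

Lemma skew_diag0 n (A : 'M[F]_n) i : A^T = - A -> A i i = 0.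
Proof.
move=> /matrixP/(_ i i); rewrite !mxE => /eqP; rewrite -addr_eq0 -mulr2n.
by rewrite -mulr_natl mulf_eq0 (negPf two_neq0) => /eqP.
Qed.

(* Choosing a pivot [a = A i j] of minimal valuation makes the two columns [x]
   and [y] below integral; subtracting [a (x y^T - y x^T)] clears the [i]-th row
   and column of [A]. *)
Lemma skew_split n (A : 'M[F]_n) : A^T = - A ->
  exists G : 'M[R]_n, A = map_mx f G *m A + A *m (map_mx f G)^T.
Proof.
(* Induction on the number of nonzero rows. *)
have [m] := ubnP #|[pred i | row i A != 0]|; elim: m A => // m IHm A leAm skA.
have [->|A_neq0] := eqVneq A 0; first by exists 0; rewrite mulmx0 mul0mx addr0.
have [k0 _] : exists k, row k A != 0.
  apply/existsP; apply: contra_neqT A_neq0; rewrite negb_exists => /forallP A0.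
  by apply/row_matrixP => k; rewrite row0; apply/eqP; rewrite -[_ == _]negbK.
have [[i j] /= min_a] := exists_common_divisor (fun p => A p.1 p.2) (k0, k0).
set a := A i j in min_a.
have a_neq0 : a != 0.
  apply: contra_neq A_neq0 => a0; apply/matrixP => k l.
  by have [r /= ->] := min_a (k, l); rewrite a0 mulr0 mxE.
have [x0 x0P] := fin_all_exists (fun k => min_a (k, j)).
have [y0 y0P] := fin_all_exists (fun k => min_a (i, k)).
pose x : 'cV[R]_n := \col_k x0 k; pose y : 'cV[R]_n := \col_k y0 k.
pose ei : 'rV[R]_n := delta_mx 0 i; pose ej : 'rV[R]_n := delta_mx 0 j.
have rowi : map_mx f ei *m A = a *: (map_mx f y)^T.
  by rewrite map_delta_mx -rowE; apply/matrixP => u k; rewrite !mxE y0P mulrC.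
have skewE k l : A k l = - A l k.
  by move/matrixP/(_ l k): skA; rewrite !mxE.
have rowj : map_mx f ej *m A = - a *: (map_mx f x)^T.
  rewrite map_delta_mx -rowE; apply/matrixP => u k.
  by rewrite !mxE skewE x0P mulNr mulrC.
(* The row operation [Q] subtracts [x] times row [i] and [y] times row [j]. As [Q A] is again skew,
   it also equals [A Q^T], so zero rows of [A] stay zero. *)
pose Q := 1%:M - x *m ei - y *m ej.
pose A' := map_mx f Q *m A.
have A'E : A' = A - a *: (map_mx f x *m (map_mx f y)^T)
                  + a *: (map_mx f y *m (map_mx f x)^T).
  rewrite /A' /Q !map_mxB !map_mxM map_mx1 !mulmxBl mul1mx -!mulmxA rowi rowj.
  by rewrite -!scalemxAr scaleNr opprK.
have skA' : A'^T = - A'.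
  rewrite A'E 2!linearD /= linearN /= !linearZ /= !trmx_mul !trmxK skA.
  by rewrite !opprD !scalerN !opprK addrAC.
have A'Q : A' = A *m (map_mx f Q)^T.
  by rewrite -[A']opprK -skA' trmx_mul skA mulNmx opprK.
have [|//|G' G'P] := IHm A'.
  rewrite -ltnS; apply: leq_trans leAm; rewrite ltnS; apply: proper_card.
  apply/properP; split.
    apply/subsetP => k; rewrite !inE; apply: contra => /eqP Ak0.
    by rewrite A'Q row_mul Ak0 mul0mx.
  exists i; rewrite !inE ?negbK.
    by apply: contra_neq a_neq0 => /matrixP/(_ 0 j); rewrite !mxE.
  have fxi : f (x0 i) = 1 by apply: (mulIf a_neq0); rewrite mul1r -x0P.
  have fyi : f (y0 i) = 0.
    by apply: (mulIf a_neq0); rewrite mul0r -y0P /= skew_diag0.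
  apply/eqP/matrixP => u k; rewrite A'E !mxE !big_ord1 !mxE fxi fyi y0P /=.
  by rewrite mul1r mul0r mulr0 addr0 mulrC subrr.
(* The term [x ei] accounts for [A - A']. The rest comes from [G' A' = (G' Q) A] and
   [A' G'^T = A (G' Q)^T]. *)
exists (x *m ei + G' *m Q).
have AE : A = A' + map_mx f x *m map_mx f ei *m A
               + A *m (map_mx f x *m map_mx f ei)^T.
  have -> : A *m (map_mx f x *m map_mx f ei)^T
    = - (map_mx f x *m map_mx f ei *m A)^T.
    by rewrite [in RHS]trmx_mul skA mulNmx opprK.
  rewrite -mulmxA rowi -scalemxAr linearZ /= trmx_mul trmxK A'E.
  by rewrite addrAC addrK subrK.
rewrite {1}AE G'P map_mxD !map_mxM.
rewrite {1}/A' A'Q linearD /= mulmxDl mulmxDr -!mulmxA -trmx_mul.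
by rewrite [X in X + _ = _]addrAC -[LHS]addrA; congr (_ + _); apply: addrC.
Qed.

(* For [A = G A + A G^T] one has [tr (A C) = 2 tr (G A C)], even though the
   entries of [A] and [C] need not be integral. *)
Lemma even_trace_skew_mul n (A C : 'M[F]_n) (M : 'M[R]_n) : injective f ->
  A^T = - A -> C^T = - C -> A *m C = map_mx f M ->
  exists m, \tr M = m *+ 2.
Proof.
move=> f_inj skA skC ACM; have [G GP] := skew_split skA.
exists (\tr (G *m M)); apply: f_inj.
rewrite rmorphMn -!trace_map_mx map_mxM -ACM {1}GP mulmxDl mxtraceD mulr2n.
rewrite !mulmxA; congr (_ + _); rewrite -mxtrace_tr !trmx_mul trmxK skA skC.
by rewrite mulNmx !mulmxN opprK mxtrace_mulC.
Qed.

End SkewSplitting.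

Lemma mulmxnAl (R : pzRingType) m n p (M : 'M[R]_(m, n)) (N : 'M_(n, p)) k :
  (M *+ k) *m N = (M *m N) *+ k.
Proof. by rewrite -!scaler_nat scalemxAl. Qed.

Lemma mulmxnAr (R : pzRingType) m n p (M : 'M[R]_(m, n)) (N : 'M_(n, p)) k :
  M *m (N *+ k) = (M *m N) *+ k.
Proof. exact: raddfMn. Qed.

Lemma mxtraceB (R : pzRingType) n (M N : 'M[R]_n) :
  \tr (M - N) = \tr M - \tr N.
Proof. exact: raddfB. Qed.

Lemma mxtraceMn (R : pzRingType) n (M : 'M[R]_n) k :
  \tr (M *+ k) = \tr M *+ k.
Proof. exact: raddfMn. Qed.

(** * Parity of traces and adjoints *)

Section Adjoint.

Variables (R : comUnitRingType) (F : fieldType) (f : {rmorphism R -> F}).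
Hypothesis f_valuation : forall x y : F,
  (exists r, y = f r * x) \/ (exists r, x = f r * y).
Hypothesis f_inj : injective f.
Hypothesis two_neq0 : 2 != 0 :> F.

Definition even (x : R) : Prop := exists z, x = z *+ 2.

Lemma even_mul2 x : even (x *+ 2). Proof. by exists x. Qed.

Lemma evenD x y : even x -> even y -> even (x + y).
Proof. by move=> [z ->] [t ->]; exists (z + t); rewrite mulrnDl. Qed.

Lemma evenN x : even x -> even (- x).
Proof. by move=> [z ->]; exists (- z); rewrite mulNrn. Qed.

Lemma evenMl x y : even y -> even (x * y).
Proof. by move=> [z ->]; exists (x * z); rewrite mulrnAr. Qed.

Lemma mulr2_inj : injective (fun x : R => x *+ 2).
Proof.
move=> x y /(congr1 f); rewrite /= !rmorphMn -[f x *+ 2]mulr_natl.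
rewrite -[f y *+ 2]mulr_natl => xy.
by apply/f_inj/(mulfI two_neq0).
Qed.

(** The terms at (i, j) and (j, i) pair up, so half the sum is the part below the diagonal. *)
Lemma even_sum_sym n (g : 'I_n -> 'I_n -> R) :
  (forall i j, g i j = g j i) -> (forall i, g i i = 0) ->
  even (\sum_i \sum_j g i j).
Proof.
move=> g_sym g_diag; exists (\sum_(i < n) \sum_(j < n | (j < i)%N) g i j).
have splitE i : \sum_j g i j =
    \sum_(j < n | (j < i)%N) g i j + \sum_(j < n | (i < j)%N) g i j.
  rewrite (bigID (fun j : 'I_n => (j < i)%N)) /=; congr (_ + _).
  rewrite (bigD1 i) ?ltnn //= g_diag add0r; apply: eq_bigl => j.
  by rewrite -leqNgt [RHS]ltn_neqAle eq_sym andbC.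
rewrite (eq_bigr _ (fun i _ => splitE i)) big_split mulr2n; congr (_ + _).
under eq_bigr do rewrite big_mkcond; rewrite exchange_big /=.
apply: eq_bigr => i _; rewrite [RHS]big_mkcond; apply: eq_bigr => j _.
by rewrite g_sym.
Qed.

(** Tr X^2 - (Tr X)^2 is a double sum of X_ij X_ji - X_ii X_jj, symmetric in i, j and zero on the
    diagonal. *)
Lemma even_trace_sqr n (X : 'M[R]_n) : even (\tr X) -> even (\tr (X *m X)).
Proof.
move=> trX; have -> : \tr (X *m X) = \tr X * \tr X
    + \sum_i \sum_j (X i j * X j i - X i i * X j j).
  rewrite /mxtrace big_distrlr -big_split /=; apply: eq_bigr => i _.
  rewrite mxE -big_split; apply: eq_bigr => j _ /=.
  by rewrite addrC subrK.
apply: evenD; first exact: evenMl.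
apply: even_sum_sym => [i j|i]; last by rewrite subrr.
by rewrite mulrC [X i i * _]mulrC.
Qed.

Variables (n : nat) (B : 'M[F]_n).
Hypotheses (B_unit : B \in unitmx) (B_sym : B^T = B).
Implicit Types M N T U P W X Y Z : 'M[R]_n.

(** A relation rather than a function, since the adjoint B^-1 M^T B of an integral matrix need not
    be integral. *)
Definition adjoint M N : Prop := (map_mx f M)^T *m B = B *m map_mx f N.

Lemma adjoint1 : adjoint 1%:M 1%:M.
Proof. by rewrite /adjoint map_mx1 trmx1 mul1mx mulmx1. Qed.

Lemma adjoint_sym M N : adjoint M N -> adjoint N M.
Proof.
by move=> /(congr1 trmx); rewrite /adjoint !trmx_mul trmxK B_sym.
Qed.

Lemma adjointB M N M' N' :
  adjoint M N -> adjoint M' N' -> adjoint (M - M') (N - N').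
Proof.
by rewrite /adjoint !map_mxB linearB /= mulmxBl mulmxBr => -> ->.
Qed.

Lemma adjointM M N M' N' :
  adjoint M N -> adjoint M' N' -> adjoint (M *m M') (N' *m N).
Proof.
rewrite /adjoint !map_mxM trmx_mul => MN MN'.
by rewrite -mulmxA MN mulmxA MN' mulmxA.
Qed.

Lemma adjoint_half M N : adjoint (M *+ 2) (N *+ 2) -> adjoint M N.
Proof.
rewrite /adjoint !raddfMn /= mulmxnAl => /eqP.
rewrite -subr_eq0 -mulrnBl -scaler_nat scaler_eq0 (negPf two_neq0) subr_eq0.
by move=> /eqP.
Qed.

(** Over [F], M^T and N are conjugate by B. *)
Lemma adjoint_trace M N : adjoint M N -> \tr M = \tr N.
Proof.
move=> MN; apply: f_inj; rewrite -!trace_map_mx -mxtrace_tr.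
rewrite -[(map_mx f M)^T](mulmxK B_unit) MN mxtrace_mulC mulmxA.
by rewrite mulVmx // mul1mx.
Qed.

Lemma even_trace_mul_skew T W :
  adjoint T (- T) -> adjoint W (- W) -> even (\tr (T *m W)).
Proof.
move=> skT skW.
apply: (even_trace_skew_mul f_valuation two_neq0 (A := map_mx f T *m invmx B)
  (C := B *m map_mx f W)) => //.
- rewrite trmx_mul trmx_inv B_sym -[(map_mx f T)^T](mulmxK B_unit) skT.
  by rewrite map_mxN mulmxN mulNmx mulmxN -mulmxA mulKmx.
- by rewrite trmx_mul B_sym skW map_mxN mulmxN.
- by rewrite mulmxA mulmxKV // map_mxM.
Qed.

(** Taking determinants gives (det U)^2 = 1, already in [R], so the inverse is integral. *)
Lemma isometry_adjoint U : (map_mx f U)^T *m B *m map_mx f U = B ->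
  U \in unitmx /\ adjoint U (invmx U).
Proof.
move=> UBU.
have U_unit : U \in unitmx.
  have detB : \det B != 0 by rewrite -unitfE -unitmxE.
  have /(congr1 determinant) := UBU; rewrite !det_mulmx det_tr det_map_mx.
  rewrite mulrAC -[RHS]mul1r => /(mulIf detB); rewrite -rmorphM -(rmorph1 f).
  by move=> /f_inj detU; rewrite unitmxE; apply/unitrP; exists (\det U).
split=> //; rewrite /adjoint -[in RHS]UBU -!mulmxA -map_mxM mulmxV //.
by rewrite map_mx1 mulmx1.
Qed.

(* [P] and [Q] are the inverses of [U] and [V]; in the application [U = U1] and
   [V = U1^-1 U2]. *)
Section CongruentIsometries.

Variables U P V Q X : 'M[R]_n.
Hypothesis UP : U *m P = 1%:M.
Hypotheses (VQ : V *m Q = 1%:M) (VE : V = 1%:M + X *+ 4).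
Hypotheses (adjU : adjoint U P) (adjV : adjoint V Q).

Lemma inverse_expand : Q = 1%:M - (X *m Q) *+ 4.
Proof.
by rewrite -VQ VE mulmxDl mul1mx mulmxnAl addrK.
Qed.

(** The adjoint of 4 X = V - 1 is Q - 1 = - 4 X Q; halve twice. *)
Lemma adjoint_quarter : adjoint X (- (X *m Q)).
Proof.
do 2!apply: adjoint_half; rewrite -!mulrnA.
have -> : X *+ (2 * 2) = V - 1%:M by rewrite VE addrC addKr.
have -> : (- (X *m Q)) *+ (2 * 2) = Q - 1%:M.
  by rewrite [in RHS]inverse_expand addrC addKr mulNrn.
exact: adjointB adjV adjoint1.
Qed.

Lemma skew_half W M N : adjoint M N -> adjoint N M -> W *+ 2 = M - N ->
  adjoint W (- W).
Proof.
move=> MN NM WE; apply: adjoint_half; rewrite mulNrn WE opprB.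
exact: adjointB.
Qed.

Lemma trace_mul_expand W : W *+ 2 = U - P ->
  \tr (U *m X) = \tr (X *m W) + \tr (X *m X *m Q *m P) *+ 2.
Proof.
move=> WE.
have XW : \tr (X *m W) *+ 2 = \tr (U *m X) - \tr (X *m P).
  by rewrite -[LHS]raddfMn -mulmxnAr WE mulmxBr raddfB /= mxtrace_mulC.
(* Pass to the adjoint - X Q P of U X, then expand Q = 1 - 4 X Q. Adding [XW] gives twice the
   claim. *)
have UX : \tr (U *m X) = \tr (X *m X *m Q *m P) *+ 4 - \tr (X *m P).
  rewrite (adjoint_trace (adjointM adjU adjoint_quarter)) mulNmx raddfN /=.
  rewrite {1}inverse_expand mulmxBr mulmx1 mulmxnAr mulmxBl mulmxnAl.
  by rewrite raddfB raddfMn opprB !mulmxA.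
apply: mulr2_inj; rewrite /= mulrnDl XW -mulrnA mulr2n {2}UX.
by rewrite addrA addrAC.
Qed.

Lemma even_trace_quarter_mul_skew W : adjoint W (- W) -> even (\tr (X *m W)).
Proof.
move=> skW.
(* V - Q = (V^2 - 1) Q, and V^2 - 1 = 8 (X + 2 X^2). *)
pose T := (X + (X *m X) *+ 2) *m Q.
have TE : T *+ 2 *+ 2 *+ 2 = V - Q.
  have -> : V - Q = (V *m V - 1%:M) *m Q.
    by rewrite mulmxBl mul1mx -mulmxA VQ mulmx1.
  rewrite /T -!mulmxnAl; congr (_ *m _).
  rewrite VE mulmxDl mul1mx mulmxDr mulmx1 !mulmxnAl mulmxnAr.
  rewrite -[X in _ = X - _]addrA [X in _ = X - _]addrC addrK [RHS]addrA.
  rewrite -[in RHS]mulrnDr.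
  by rewrite -!mulrnA mulrnDl -mulrnA.
have skT : adjoint T (- T).
  do 2!apply: adjoint_half; rewrite !mulNrn.
  by apply: skew_half TE => //; apply: adjoint_sym.
have XE : X = T + (X *m X *m Q) *+ 2.
  rewrite /T mulmxDl mulmxnAl -addrA -mulrnDr {1}inverse_expand.
  by rewrite mulmxBr mulmx1 mulmxnAr mulmxA subrK.
rewrite {1}XE mulmxDl mulmxnAl mxtraceD raddfMn.
by apply: evenD (even_mul2 _); apply: even_trace_mul_skew.
Qed.

Lemma even_trace_mul Y : U *m U = 1%:M + Y *+ 2 -> even (\tr (U *m X)).
Proof.
(* U - P = (U^2 - 1) P. *)
move=> UUE; have WE : (Y *m P) *+ 2 = U - P.
  by rewrite -mulmxnAl -[Y *+ 2](addKr 1%:M) -UUE mulmxDl mulNmx mul1mx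
    -mulmxA UP mulmx1 addrC.
rewrite (trace_mul_expand WE).
apply: evenD (even_mul2 _); apply: even_trace_quarter_mul_skew.
by apply: skew_half WE => //; apply: adjoint_sym.
Qed.

Lemma four_dvd_trace_mul Z : U = 1%:M + Z *+ 2 ->
  exists z, \tr (U *m X) = z *+ 4.
Proof.
move=> UE; pose Y := Z + Z *m Z.
have UUE : U *m U = 1%:M + Y *+ 2 *+ 2.
  have -> : Y *+ 2 *+ 2 = Z *+ (2 + 2) + (Z *m Z) *+ 4.
    by rewrite -mulrnA mulrnDl.
  rewrite UE mulmxDl mul1mx mulmxDr mulmx1 mulmxnAl mulmxnAr -mulrnA.
  by rewrite -[LHS]addrA [X in _ + X = _]addrA -[X in _ + (X + _) = _]mulrnDr.
have even_UX : even (\tr (U *m X)) by apply: even_trace_mul UUE.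
have WE : (Y *m P) *+ 2 *+ 2 = U - P.
  by rewrite -!mulmxnAl -[Y *+ 2 *+ 2](addKr 1%:M) -UUE mulmxDl mulNmx mul1mx
    -mulmxA UP mulmx1 addrC.
have skYP : adjoint (Y *m P) (- (Y *m P)).
  apply: adjoint_half; rewrite mulNrn.
  by apply: skew_half WE => //; apply: adjoint_sym.
(* U = 1 mod 2, hence Tr X = Tr (U X) mod 2. *)
have even_X : even (\tr X).
  have -> : \tr X = \tr (U *m X) - \tr (Z *m X) *+ 2.
    by rewrite UE mulmxDl mul1mx mulmxnAl mxtraceD raddfMn addrK.
  by apply: evenD even_UX _; apply/evenN/even_mul2.
(* Both Q and P are 1 mod 2, so this trace is Tr X^2 mod 2. *)
have [z XXQP] : even (\tr (X *m X *m Q *m P)).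
  have -> : \tr (X *m X *m Q *m P) =
      \tr (X *m X)
      - (\tr (X *m X *m Z *m P) + \tr (X *m X *m (X *m Q) *m P) *+ 2) *+ 2.
    have PE : P = 1%:M - (Z *m P) *+ 2.
      by rewrite -UP UE mulmxDl mul1mx mulmxnAl addrK.
    rewrite {1}inverse_expand mulmxBr mulmx1 mulmxnAr mulmxBl mulmxnAl.
    rewrite {1}PE mulmxBr mulmx1 mulmxnAr !mxtraceB !mxtraceMn !mulmxA.
    by rewrite mulrnDl [in RHS]opprD [RHS]addrA -mulrnA.
  apply: evenD; first exact: even_trace_sqr.
  exact/evenN/even_mul2.
have [t XYP] := even_trace_quarter_mul_skew skYP.
exists (t + z); rewrite (trace_mul_expand WE) mulmxnAr mxtraceMn XYP XXQP.
by rewrite -!mulrnA mulrnDl.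
Qed.

End CongruentIsometries.
End Adjoint.

(** * Gram matrices *)

Definition gram_mx (F : fieldType) n (b : {symmetric 'cV[F]_n}) : 'M[F]_n :=
  \matrix_(i, j) b (delta_mx i 0) (delta_mx j 0).

Lemma gram_mxE (F : fieldType) n (b : {symmetric 'cV[F]_n}) u v :
  b u v = (u^T *m gram_mx b *m v) 0 0.
Proof.
have colE (w : 'cV[F]_n) : w = \sum_i w i 0 *: delta_mx i 0.
  by rewrite {1}[w]matrix_sum_delta; apply: eq_bigr => i _; rewrite big_ord1.
rewrite {1}[u]colE {1}[v]colE linear_sumlz -mulmxA mxE; apply: eq_bigr => i _.
rewrite linear_sumr !mxE mulr_sumr; apply: eq_bigr => j _.
by rewrite linearZlr /= mxE; congr (_ * _); apply: mulrC.
Qed.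

Lemma gram_mx_tr (F : fieldType) n (b : {symmetric 'cV[F]_n}) :
  (gram_mx b)^T = gram_mx b.
Proof.
by apply/matrixP => i j; rewrite !mxE hermC /= expr0 mul1r.
Qed.

Lemma gram_mx_unit (F : fieldType) n (b : {symmetric 'cV[F]_n}) :
  nondegenerate b -> gram_mx b \in unitmx.
Proof.
move=> /eqP rad0; rewrite -row_free_unit; apply: inj_row_free => w wB.
apply: trmx_inj; apply/eqP; rewrite trmx0 -memv0 -rad0.
by apply/mem_orthovP => v _; rewrite gram_mxE trmxK wB mul0mx mxE.
Qed.

Lemma gram_mx_isometry (F : fieldType) n (b : {symmetric 'cV[F]_n})
    (U : 'M[F]_n) :
  isometry b b (mulmx U) -> U^T *m gram_mx b *m U = gram_mx b.
Proof.
move=> U_iso; apply/matrixP => i j; rewrite [RHS]mxE -U_iso gram_mxE.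
rewrite trmx_mul trmx_delta !mulmxA -rowE -!row_mul.
by rewrite -colE [RHS]mxE [RHS]mxE.
Qed.

(** * Valuations on fraction fields and on the 2-adic integers *)

Lemma frac_numdenP (R : idomainType) (x : {fraction R}) :
  exists a b : R, b != 0 /\ x = FracField.tofrac a / FracField.tofrac b.
Proof.
elim/quotW: x => x; exists (\n_x), (\d_x).
have d_neq0 : FracField.tofrac \d_x != 0 by rewrite tofrac_eq0 denom_ratioP.
split; first exact: denom_ratioP.
apply: (mulIf d_neq0); rewrite divfK //; unlock FracField.tofrac.
rewrite -[LHS]FracField.pi_mul /FracField.mulf /=; apply/eqmodP.
by rewrite /= FracField.equivfE !numden_Ratio ?mulf_neq0 ?oner_eq0 ?denom_ratioP
  ?mulr1 1?mulrC.
Qed.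

Lemma frac_valuation (R : idomainType) :
  (forall x y : R, (exists z, y = z * x) \/ (exists z, x = z * y)) ->
  forall x y : {fraction R}, (exists z, y = FracField.tofrac z * x) \/
                             (exists z, x = FracField.tofrac z * y).
Proof.
move=> R_valuation x y.
have [a [b [b_neq0 ->]]] := frac_numdenP x.
have [c [d [d_neq0 ->]]] := frac_numdenP y.
have cross (p q r t z : R) : q != 0 -> t != 0 -> r * q = z * (p * t) ->
    FracField.tofrac r / FracField.tofrac t
    = FracField.tofrac z * (FracField.tofrac p / FracField.tofrac q).
  move=> q_neq0 t_neq0 /(congr1 (@FracField.tofrac R)); rewrite !tofracM => E.
  rewrite mulrA; apply/eqP; rewrite eqr_div ?tofrac_eq0 //.
  by rewrite E mulrA.
have [[z E]|[z E]] := R_valuation (a * d) (c * b); [left | right].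
  by exists z; apply: cross.
by exists z; apply: cross.
Qed.

Lemma ltn_residue (x : Z2adic) k : (x k < 2 ^ k.+1)%N.
Proof. by rewrite -[X in (_ < X)%N]residue_trunc ltn_ord. Qed.

(** Halving costs one binary digit: [x] modulo 2^(k+2) determines [y] modulo 2^(k+1). This index
    shift drives the induction in [Z2adic_normal]. *)
Lemma Z2adic_half (x : Z2adic) : x 0 = 0 ->
  exists2 y : Z2adic, x = y *+ 2 & forall k, x k.+1 = (y k).*2 :> nat.
Proof.
move=> x0.
have x_even k : ~~ odd (x k).
  have := residue_add x 0 k; rewrite add0n x0 mod0n => /eqP.
  by rewrite expn1 -/(2 %| _)%N dvdn2.
have xE k : x k.+1 = (x k.+1)./2.*2 :> nat by rewrite even_halfK.
have half_lt k : ((x k.+1)./2 < (Zp_trunc (2 ^ k.+1)).+2)%N.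
  by rewrite [ltnRHS]residue_trunc ltn_half_double -mul2n -expnS ltn_residue.
have halfP k : (x k.+2)./2 = (x k.+1)./2 %[mod 2 ^ k.+1].
  apply/eqP; rewrite -(eqn_pmul2l (isT : 0 < 2)%N) !muln_modr -expnS !mul2n.
  by rewrite -!xE; apply/eqP/residueP.
exists (MkZ2adic (residue := fun k => Ordinal (half_lt k)) halfP) => //.
apply: Z2adicP => k; apply: val_inj => /=.
rewrite [X in (_ %% X)%N]residue_trunc addnn -xE residueP modn_small //.
exact: ltn_residue.
Qed.

(** An odd residue is invertible at every level, and uniqueness of inverses makes them
    compatible. *)
Lemma Z2adic_unitE (x : Z2adic) : x 0 != 0 -> x \is a GRing.unit.
Proof.
move=> x0.
have x_unit k : x k \is a GRing.unit.
  rewrite -[x k]natr_Zp unitZpE ?expn2_gt1 // coprimeXl // coprime2n.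
  have := residue_ndvd k x0; rewrite add0n expn1 dvdn2 negbK; exact.
have xV k : (x k * (x k)^-1 = 1 %[mod 2 ^ k.+1])%N.
  have := congr1 (fun z : 'Z_(2 ^ k.+1) => z %% 2 ^ k.+1)%N (mulrV (x_unit k)).
  by rewrite /= !residue_mod_trunc.
have invP k : (x k.+1)^-1 = (x k)^-1 %[mod 2 ^ k.+1].
  set a := nat_of_ord _; set b := nat_of_ord (x k)^-1.
  have xa : (x k * a = 1 %[mod 2 ^ k.+1])%N.
    rewrite -modnMml -residueP modnMml.
    rewrite -(modn_dvdm _ (_ : 2 ^ k.+1 %| 2 ^ k.+2)%N) ?xV ?modn_dvdm //;
    by rewrite dvdn_exp2l.
  by rewrite -[a in LHS]mul1n -modnMml -(xV k) modnMml mulnAC -modnMml xa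
    modnMml mul1n.
apply/unitrP; exists (MkZ2adic (residue := fun k => (x k)^-1) invP).
by split; apply: Z2adicP => k;
  [apply: mulVr (x_unit k) | apply: mulrV (x_unit k)].
Qed.

(** Induction on an index with nonzero residue, which drops by one with each division by 2. *)
Lemma Z2adic_normal (x : Z2adic) : x != 0 ->
  exists k, exists2 u : Z2adic, u \is a GRing.unit & x = u *+ 2 ^ k.
Proof.
move=> x_neq0.
have [m] : exists m, x m != 0.
  apply: contrapT => xm; move/eqP: x_neq0; apply; apply: Z2adicP => m.
  by apply/eqP; apply: contrapT => xm0; apply: xm; exists m; apply/negP.
elim: m x {x_neq0} => [|m IHm] x xm.
  by exists 0, x; rewrite ?expn0 //; apply: Z2adic_unitE.
have [/Z2adic_half[y xy xE]|x0] := eqVneq (x 0) 0; last first.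
  by exists 0, x; rewrite ?expn0 //; apply: Z2adic_unitE.
have [|k [u u_unit yE]] := IHm y; last first.
  by exists k.+1, u; rewrite // xy yE expnSr mulrnA.
apply: contra_neq xm => ym; apply: val_inj; rewrite /= xE.
by rewrite ym.
Qed.

Lemma Z2adic_valuation (x y : Z2adic) :
  (exists z, y = z * x) \/ (exists z, x = z * y).
Proof.
have [->|/Z2adic_normal[k [u u_unit ->]]] := eqVneq x 0.
  by right; exists 0; rewrite mul0r.
have [->|/Z2adic_normal[l [v v_unit ->]]] := eqVneq y 0.
  by left; exists 0; rewrite mul0r.
wlog le_kl : k l u v u_unit v_unit / (k <= l)%N.
  move=> wlog_kl; case: (leqP k l) => [|/ltnW] le_kl; first exact: wlog_kl.
  by apply/or_comm/wlog_kl.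
left; exists (v / u *+ 2 ^ (l - k)).
by rewrite mulrnAl mulrnAr divrK // -mulrnA -expnD subnKC.
Qed.

(** * The trace congruences *)

Lemma congr_mxP m n (A B : 'M[Z2adic]_n) : congr_mx_mod m A B ->
  exists C, A = B + C *+ m.
Proof.
move=> AB; have [c cP] := fin_all_exists (fun i => fin_all_exists (AB i)).
exists (\matrix_(i, j) c i j); apply/matrixP => i j.
by rewrite !mxE mulmxnE mxE -mulr_natl -cP addrC subrK.
Qed.

Theorem theorem4p1 (n : nat) (b : {symmetric 'cV[Q2adic]_n})
    (b_nondeg : nondegenerate b) (U1 U2 : 'M[Z2adic]_n)
    (U1_orth : orthogonal_wrt b U1) (U2_orth : orthogonal_wrt b U2)
    (U12 : congr_mx_mod 4 U1 U2) :
  (congr_mx_mod 2 U1 1%:M -> congr_mod 16 (\tr U1) (\tr U2)) /\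
  (congr_mx_mod 2 (U1 *m U1) 1%:M -> congr_mod 8 (\tr U1) (\tr U2)).
Proof.
set tofrac := @FracField.tofrac Z2adic.
have val := frac_valuation Z2adic_valuation.
have tofrac_inj : injective tofrac.
  by move=> x y /eqP; rewrite tofrac_eq => /eqP.
have two_neq0 : 2 != 0 :> Q2adic.
  rewrite -(rmorph_nat tofrac) tofrac_eq0; apply/eqP.
  (* Index 1 is reduction modulo 4, where 2 does not vanish. *)
  by move=> /(congr1 (fun x : Z2adic => nat_of_ord (x 1))).
have B_unit := gram_mx_unit b_nondeg; have B_sym := gram_mx_tr b.
have [U1_unit adjU1] :=
  isometry_adjoint tofrac_inj B_unit (gram_mx_isometry U1_orth).
have [U2_unit adjU2] :=
  isometry_adjoint tofrac_inj B_unit (gram_mx_isometry U2_orth).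
have [Y U12E] := congr_mxP U12.
(* From U1 = U2 + 4 Y one gets U1^-1 U2 = 1 - 4 U1^-1 Y. *)
pose X := - (invmx U1 *m Y).
have UX : U1 *m X = - Y by rewrite mulmxN mulKVmx.
have VE : invmx U1 *m U2 = 1%:M + X *+ 4.
  have -> : U2 = U1 - Y *+ 4 by rewrite U12E addrK.
  by rewrite mulmxBr mulVmx // mulmxnAr mulNrn.
have VQ : (invmx U1 *m U2) *m (invmx U2 *m U1) = 1%:M.
  by rewrite mulmxA mulmxK // mulVmx.
have adjV := adjointM (adjoint_sym B_sym adjU1) adjU2.
have tr12 : \tr U1 - \tr U2 = - \tr (U1 *m X) *+ 4.
  by rewrite UX {1}U12E mxtraceD mxtraceMn raddfN opprK addrAC subrr add0r.
have UP := mulmxV U1_unit.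
(* By [tr12], divisibility of Tr (U1 X) by 4 or by 2 gives the congruence modulo 16 or 8. *)
split=> [/congr_mxP[Z U1E] | /congr_mxP[Z U1E]].
  have [z trE] := four_dvd_trace_mul val tofrac_inj two_neq0 B_unit B_sym
    UP VQ VE adjU1 adjV U1E.
  by exists (- z); rewrite tr12 trE mulr_natl !mulNrn -mulrnA.
have [z trE] := even_trace_mul val tofrac_inj two_neq0 B_unit B_sym
  UP VQ VE adjU1 adjV U1E.
by exists (- z); rewrite tr12 trE mulr_natl !mulNrn -mulrnA.
Qed.
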